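(* Let $K$ be a scattered compact Hausdorff space with height at most $\omega+1$. Then $C(K)$ has the $c_0$-extension property if and only if $K$ is monolithic.
   Context: $C(K)$ is the real Banach space of real-valued continuous functions on $K$ with the supremum norm. A Banach space $X$ has the $c_0$-extension property if every bounded linear operator $T:Y\to c_0$ defined on a closed subspace $Y$ of $X$ admits a bounded linear extension $\tilde T:X\to c_0$. A compact Hausdorff space is monolithic if every separable subspace of it is second countable. A topological space $X$ is scattered if for every closed subspace $Y$ of $X$ the set of isolated points of $Y$ is dense in $Y$; equivalently, $X^{(\alpha)}=\emptyset$ for some ordinal $\alpha$, where $X^{(\alpha)}$ is the $\alpha$-th Cantor--Bendixson derivative of $X$ ($X^{(0)}=X$, $X^{(\alpha+1)}$ is the set of non-isolated points of $X^{(\alpha)}$, and intersections are taken at limit ordinals). The height of a scattered space $X$ is the least ordinal $\alpha$ with $X^{(\alpha)}=\emptyset$. *)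

(* Defs.v *)
From HB Require Import structures.
From mathcomp Require Import all_boot all_order all_algebra.
From mathcomp Require Import all_classical all_reals all_analysis.

Set Implicit Arguments.
Unset Strict Implicit.
Unset Printing Implicit Defensive.

Import Order.TTheory GRing.Theory Num.Theory.
Import numFieldNormedType.Exports.

Local Open Scope classical_set_scope.
Local Open Scope ring_scope.

(* A linear subspace S of the bounded real functions on T, with the supremum
   norm. The boundedness proof is an index of the type, since the supremum is a
   norm only under that condition. *)
Definition supspace (R : realType) (T : Type)
    (S : GRing.SubmodClosed.type (T -> R))
    (bS : forall f, f \in S -> has_ubound (range (fun x => `|f x|))) : Type :=
  {f : T -> R | f \in S}.

Section supspace.
Context (R : realType) (T : Type) (S : GRing.SubmodClosed.type (T -> R)).
Context (bS : forall f, f \in S -> has_ubound (range (fun x => `|f x|))).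

Local Notation V := (supspace bS).

HB.instance Definition _ := SubChoice.copy V {f : T -> R | f \in S}.
HB.instance Definition _ := [SubChoice_isSubLmodule of V by <:].

Definition supnorm (f : V) : R := sup (range (fun x => `|val f x|)).

Lemma ler_supnorm (f : V) x : `|val f x| <= supnorm f.
Proof. by apply: ub_le_sup; [exact/bS/valP | exists x]. Qed.

Lemma supnorm_le (f : V) M : 0 <= M -> (forall x, `|val f x| <= M) ->
  supnorm f <= M.
Proof.
move=> M0 fM; rewrite /supnorm.
have [->|/set0P ne] := eqVneq (range (fun x => `|val f x|)) set0.
  by rewrite sup0.
by apply: ge_sup => // _ [x _ <-].
Qed.

Lemma supnorm_ge0 (f : V) : 0 <= supnorm f.
Proof.
rewrite /supnorm.
have [->|/set0P[_ [x _ _]]] := eqVneq (range (fun x => `|val f x|)) set0.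
  by rewrite sup0.
exact: le_trans (ler_supnorm f x).
Qed.

Let supnormD (f g : V) : supnorm (f + g) <= supnorm f + supnorm g.
Proof.
apply: supnorm_le => [|x]; first by rewrite addr_ge0 ?supnorm_ge0.
rewrite raddfD /=; apply: le_trans (ler_normD _ _) _.
by apply: lerD; exact: ler_supnorm.
Qed.

Let supnormZ_le (a : R) (f : V) : supnorm (a *: f) <= `|a| * supnorm f.
Proof.
apply: supnorm_le => [|x]; first by rewrite mulr_ge0 ?supnorm_ge0.
have -> : val (a *: f) = a *: val f by [].
by rewrite normrM ler_wpM2l // ler_supnorm.
Qed.

Let supnormZ (a : R) (f : V) : supnorm (a *: f) = `|a| * supnorm f.
Proof.
apply/eqP; rewrite eq_le supnormZ_le /=.
have [->|a0] := eqVneq a 0; first by rewrite normr0 mul0r supnorm_ge0.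
rewrite -ler_pdivlMl ?normr_gt0 // -normfV.
by apply: le_trans (supnormZ_le _ _); rewrite scalerA mulVf // scale1r.
Qed.

Let supnorm0 (f : V) : supnorm f = 0 -> f = 0.
Proof.
move=> f0; apply/val_inj/funext => x.
by apply/eqP; rewrite -normr_le0 -f0; exact: ler_supnorm.
Qed.

HB.instance Definition _ :=
  @Lmodule_isNormed.Build R V supnorm supnormD supnormZ supnorm0.

Lemma supspace_cauchy_cvg
    (uS : forall f : T -> R, (forall e : R, 0 < e ->
       exists2 g, g \in S & forall x, `|f x - g x| <= e) -> f \in S)
    (F : set_system V) : ProperFilter F -> cauchy F -> cvg F.
Proof.
move=> FF /cauchyP Fc.
have distV (f g : V) x : `|val f x - val g x| <= `|f - g|.
  by have := ler_supnorm (f - g) x; rewrite raddfB.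
have Fx x : cvg ((fun f : V => val f x) @ F).
  apply: cauchy_cvg; apply/cauchyP => e e0.
  have [f Ff] := Fc e e0; exists (val f x).
  change (F [set g : V | ball (val f x) e (val g x)]).
  apply: filterS Ff => g; rewrite -!ball_normE /= => fg.
  exact: le_lt_trans (distV f g x) fg.
pose l (x : T) : R := lim ((fun f : V => val f x) @ F).
have lP e (f : V) : F (ball f e) -> forall x, `|l x - val f x| <= e.
  move=> Ff x; rewrite distrC.
  apply: (@closed_cvg _ _ F _ (fun g : V => val g x)
    [set y : R | `|val f x - y| <= e]) (Fx x).
  - exact: (@closed_closed_ball_ R R).
  - apply: filterS Ff => g; rewrite -ball_normE /= => /ltW.
    exact: le_trans (distV _ _ _).
have lS : l \in S.
  apply: uS => e e0; have [f Ff] := Fc e e0.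
  by exists (val f); [exact: valP | exact: lP].
apply/cvg_ex; exists (Sub l lS : V); apply/cvgrPdist_le => e e0.
have e2 : 0 < e / 2 by rewrite divr_gt0.
have [f Ff] := Fc _ e2.
apply: filterS (Ff) => g; rewrite -ball_normE /= => /ltW fg.
rewrite -[_ - g](subrKA f) (splitr e).
apply: le_trans (ler_normD _ _) (lerD _ fg).
by apply: supnorm_le => [|x]; [exact: ltW | rewrite raddfB /= lP].
Qed.

End supspace.

Section continuous_functions.
Context (R : realType) (K : topologicalType).

Definition cont_pred : {pred K -> R} := fun f => `[< continuous f >].

Let cont_submod : GRing.submod_closed cont_pred.
Proof.
split=> [|a f g /asboolP cf /asboolP cg]; first by apply/asboolP => x; exact: cvg_cst.
apply/asboolP => x; apply: cvgD; last exact: cg.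
by apply: cvgZr; exact: cf.
Qed.

HB.instance Definition _ :=
  GRing.isSubmodClosed.Build R (K -> R) cont_pred cont_submod.

Hypothesis cK : compact [set: K].

Lemma cont_bounded (f : K -> R) :
  f \in cont_pred -> has_ubound (range (fun x => `|f x|)).
Proof.
move=> /asboolP cf.
have /compact_bounded[M [_ Mf]] : compact (range f).
  by apply: continuous_compact => //; exact: continuous_subspaceT.
exists (M + 1) => _ [x _ <-]; apply: (Mf (M + 1)); last by exists x.
by rewrite ltrDl.
Qed.

Definition Cspace : Type := supspace cont_bounded.

Lemma cont_unif_closed (f : K -> R) :
  (forall e : R, 0 < e ->
     exists2 g, g \in cont_pred & forall x, `|f x - g x| <= e) ->
  f \in cont_pred.
Proof.
move=> fS; apply/asboolP => x; apply/cvgrPdist_le => e e0.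
have e3 : 0 < e / 3 by rewrite divr_gt0.
have [g /asboolP cg fg] := fS _ e3.
have /cvgrPdist_le /(_ _ e3) := cg x; apply: filterS => y gxy.
have -> : f x - f y = (f x - g x) + (g x - g y) - (f y - g y).
  by rewrite opprB addrA subrKA subrK.
have -> : e = e / 3 + e / 3 + e / 3.
  by rewrite -mulrDl -mulrDl -mulr2n -mulrSr -[e *+ 3]mulr_natr mulfK.
by rewrite (le_trans (ler_normB _ _))// lerD// (le_trans (ler_normD _ _))// lerD.
Qed.

HB.instance Definition _ := NormedModule.on Cspace.
HB.instance Definition _ := Uniform_isComplete.Build Cspace
  (@supspace_cauchy_cvg R K _ cont_bounded cont_unif_closed).
End continuous_functions.

Section null_sequences.
Context (R : realType).

Definition null_pred : {pred nat -> R} := fun u => `[< u @ \oo --> (0 : R) >].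

Let null_submod : GRing.submod_closed null_pred.
Proof.
split=> [|a u v /asboolP cu /asboolP cv]; first by apply/asboolP; exact: cvg_cst.
apply/asboolP; rewrite (_ : 0 = a *: 0 + 0 :> R); last by rewrite scaler0 addr0.
by apply: cvgD cv; exact: cvgZr.
Qed.

HB.instance Definition _ :=
  GRing.isSubmodClosed.Build R (nat -> R) null_pred null_submod.

Lemma null_bounded (u : nat -> R) :
  u \in null_pred -> has_ubound (range (fun n => `|u n|)).
Proof.
move=> /asboolP u0.
have /cvg_seq_bounded [M [_ Mu]] : cvgn u by apply/cvg_ex; exists 0.
by exists (M + 1) => _ [n _ <-]; apply: (Mu (M + 1)) => //; rewrite ltrDl.
Qed.

Definition c0 : Type := supspace null_bounded.

Lemma null_unif_closed (u : nat -> R) :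
  (forall e : R, 0 < e ->
     exists2 v, v \in null_pred & forall n, `|u n - v n| <= e) ->
  u \in null_pred.
Proof.
move=> uS; apply/asboolP/cvgr0Pnorm_le => e e0.
have e2 : 0 < e / 2 by rewrite divr_gt0.
have [v /asboolP v0 uv] := uS _ e2.
have /cvgr0Pnorm_le /(_ _ e2) := v0; apply: filterS => n vn.
rewrite -[u n](subrK (v n)) (splitr e).
by rewrite (le_trans (ler_normD _ _))// lerD.
Qed.

HB.instance Definition _ := NormedModule.on c0.
HB.instance Definition _ := Uniform_isComplete.Build c0
  (@supspace_cauchy_cvg R nat _ null_bounded null_unif_closed).
End null_sequences.

Definition subnormed (R : realType) (X : normedModType R)
  (Y : GRing.SubmodClosed.type X) : Type := {x : X | x \in Y}.

Section subnormed.
Context (R : realType) (X : normedModType R) (Y : GRing.SubmodClosed.type X).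

Local Notation V := (subnormed Y).

HB.instance Definition _ := SubChoice.copy V {x : X | x \in Y}.
HB.instance Definition _ := [SubChoice_isSubLmodule of V by <:].

Let nrm (y : V) : R := `|val y|.

Let nrmD (x y : V) : nrm (x + y) <= nrm x + nrm y.
Proof. by rewrite /nrm raddfD; exact: ler_normD. Qed.

Let nrmZ (a : R) (y : V) : nrm (a *: y) = `|a| * nrm y.
Proof. by rewrite /nrm linearZ; exact: normrZ. Qed.

Let nrm0 (y : V) : nrm y = 0 -> y = 0.
Proof. by move=> /normr0_eq0 y0; exact: val_inj. Qed.

HB.instance Definition _ := @Lmodule_isNormed.Build R V nrm nrmD nrmZ nrm0.
End subnormed.

Definition bounded_operator (R : realType) (V W : normedModType R)
    (T : {linear V -> W}) :=
  exists M : R, forall x, `|T x| <= M * `|x|.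

Definition c0_extension_property (R : realType) (X : completeNormedModType R) :=
  forall Y : GRing.SubmodClosed.type X, closed [set` Y] ->
  forall T : {linear subnormed Y -> c0 R}, bounded_operator T ->
  exists2 T' : {linear X -> c0 R}, bounded_operator T' &
    forall y : subnormed Y, T' (val y) = T y.

Definition separable (T : topologicalType) :=
  exists2 D : set T, countable D & dense D.

Definition monolithic (K : topologicalType) :=
  forall A : set K, separable A -> @second_countable A.

Definition scattered (X : topologicalType) :=
  forall Y : set X, closed Y -> Y `<=` closure (isolated Y).

(* Every term denotes an ordinal: [osup u] is the least upper bound of the
   family [u], hence covers the limit ordinals. Distinct terms may denote the
   same ordinal; [ole a b] says that the ordinal denoted by [a] is at most the
   one denoted by [b]. *)
Inductive ord : Type :=
| ozero
| osucc of ord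
| osup (I : Type) of I -> ord.

Fixpoint ole (a : ord) : ord -> Prop :=
  match a with
  | ozero => fun=> True
  | osucc a' => fix olt b := match b with
      | ozero => False
      | osucc b' => ole a' b'
      | osup J u => exists i, olt (u i)
      end
  | osup J u => fun b => forall i, ole (u i) b
  end.

Definition omega : ord := osup (fun n => iter n osucc ozero).

Section Cantor_Bendixson.
Context (X : topologicalType).

(* As the derivatives decrease, the clause for [osup] is also correct when the
   supremum is attained. *)
Fixpoint CBderivative (a : ord) : set X :=
  match a with
  | ozero => setT
  | osucc a' => CBderivative a' `\` isolated (CBderivative a')
  | osup J u => \bigcap_i CBderivative (u i)
  end.

Definition is_height (a : ord) :=
  CBderivative a = set0 /\ forall b, CBderivative b = set0 -> ole a b.

Lemma CBderivative_anti a b :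
  ole a b -> CBderivative b `<=` CBderivative a.
Proof.
have isoS (A B : set X) : A `<=` B -> A `\` isolated A `<=` B `\` isolated B.
  move=> AB x [Ax nix]; split; first exact: AB.
  move=> [_ [V xV VB]]; apply: nix; split; first exact/mem_set.
  exists V => //; apply/seteqP; split=> [y [Vy Ay]|y ->].
    by rewrite -VB; split=> //; exact: AB.
  by split=> //; exact: nbhs_singleton.
elim: a b => [|a IHa|J u IHu] b //=; last by move=> ub x bx i _; exact: IHu bx.
elim: b => [|b _|J v IHv] //=; first by move=> ab; exact/isoS/IHa.
by move=> [j aj] x /(_ j I); exact: IHv.
Qed.

End Cantor_Bendixson.

Arguments CBderivative X a : clear implicits.
Arguments is_height X a : clear implicits.

Lemma ole_sup (I : Type) (u : I -> ord) i a : ole a (u i) -> ole a (osup u).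
Proof.
elim: a => [|a _|J v IHv] //= ai; first by exists i.
by move=> j; apply: IHv; exact: ai.
Qed.

Lemma ole_refl a : ole a a.
Proof. by elim: a => [|a IHa|I u IHu] // i; exact: ole_sup (IHu i). Qed.

Lemma ole_trans a b c : ole a b -> ole b c -> ole a c.
Proof.
elim: a b c => [|a IHa|I u IHu] b c //; last first.
  by move=> ub bc i; exact: IHu (ub i) bc.
elim: b c => [|b _|J v IHv] c //=.
  move=> ab; elim: c => [|c _|J v IHv] //=; first exact: IHa.
  by case=> j bj; exists j; exact: IHv.
by case=> j aj vc; exact: IHv aj (vc j).
Qed.

Lemma ole_total a b : ole a b \/ ole (osucc b) a.
Proof.
elim: a b => [|a IHa|I u IHu] b; first by left.
- elim: b => [|b _|I u IHu]; first by right.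
    by have [] := IHa b; [left | right].
  have [[i ui]|nu] := pselect (exists i, ole (osucc a) (u i)).
    by left; exists i.
  by right => i; case: (IHu i) => // ui; case: nu; exists i.
- have [ub|/existsNP[i nui]] := pselect (forall i, ole (u i) b); first by left.
  by right; exists i; case: (IHu i b).
Qed.

Lemma ex_ole_min (P : ord -> Prop) a :
  P a -> exists2 m, P m & forall b, P b -> ole m b.
Proof.
suff H c p : P p -> ole (osucc p) c ->
    exists2 m, P m & forall b, P b -> ole m b.
  by move=> Pa; apply: (H (osucc a) a) => //; exact: ole_refl.
elim: c p => [|c IHc|I u IHu] p Pp //=; last by case=> i; exact: IHu.
move=> pc.
have [[q Pq qp]|nq] := pselect (exists2 q, P q & ole (osucc q) p).
  exact: IHc Pq (ole_trans qp pc).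
exists p => // b Pb; case: (ole_total p b) => // bp.
by case: nq; exists b.
Qed.

Lemma ex_height (X : topologicalType) a :
  CBderivative X a = set0 -> exists h, is_height X h.
Proof.
move=> Xa; have [h h0 hmin] := @ex_ole_min (fun b => CBderivative X b = set0) _ Xa.
by exists h.
Qed.

(* Main.v *)
(* A bounded functional on C(K), K scattered, has a closed support S; normalised
   bump functions at the isolated points of S show that these points are
   countably many, and they are dense in S.

   If K is monolithic, extend the coordinates of T : Y -> c_0 by Hahn-Banach to
   functionals psi_n. All of them live on one separable, hence second countable,
   closed set F, so that C(F) is separable and Veech's proof of Sobczyk's theorem
   corrects psi_n by elements of the annihilator of Y to a weak* null sequence.

   Conversely let F be closed and separable in K, and let F' be its set of
   non-isolated points. Evaluation at the isolated points x_n of F maps the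
   functions vanishing on F' into c_0. If (mu_n) extends it, the functionals
   delta_{x_n} - mu_n have separable supports inside F', and the union of these
   supports is dense in F': a function f vanishing on it has f(x_n) = mu_n(f) -> 0,
   hence vanishes on F'. So all finite Cantor-Bendixson derivatives of F are
   separable and have countably many isolated points. As the omega-th derivative
   is finite, F is countable, and a countable compact space is second
   countable. *)

Require Import Defs.
From HB Require Import structures.
From mathcomp Require Import all_boot all_order all_algebra.
From mathcomp Require Import all_classical all_reals all_analysis.
From mathcomp Require Import ring lra.

Set Implicit Arguments.
Unset Strict Implicit.
Unset Printing Implicit Defensive.

Import Order.TTheory GRing.Theory Num.Theory.
Import numFieldNormedType.Exports.

Local Open Scope classical_set_scope.
Local Open Scope ring_scope.

(** * Compactness as an induction principle *)

(** If [P C] failed, the sets [A] with [P (C \ A)] would form a proper filter containing [C]. It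
    contains the complement of every set satisfying [P], so it cannot cluster at a point with such a
    neighbourhood. *)
Lemma compact_ind (T : topologicalType) (C : set T) (P : set T -> Prop) :
  compact C -> P set0 -> (forall A B, A `<=` B -> P B -> P A) ->
  (forall A B, P A -> P B -> P (A `|` B)) ->
  (forall x, C x -> exists2 V, nbhs x V & P V) -> P C.
Proof.
move=> cC P0 PS PU Pl; apply: contrapT => nPC.
pose F : set_system T := [set A | P (C `\` A)].
have FF : ProperFilter F.
  split; first by rewrite /F /= setD0.
  split; rewrite /F /=; first by rewrite setDT.
  - by move=> A B /= PA PB; rewrite setDE setCI setIUr -!setDE; exact: PU.
  - by move=> A B AB; apply: PS; exact: setDS.
have [|x [Cx xF]] := cC F FF; first by rewrite /F /= setDv.
have [V xV PV] := Pl x Cx.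
have [|y [/= nVy Vy]] := xF (~` V) V _ xV; last exact: nVy.
by rewrite /F /= setDE setCK; apply: PS PV; exact: subIsetr.
Qed.

(** * The Hahn-Banach theorem for a sublinear majorant *)

Section hahn_banach.
Context (R : realType) (X : lmodType R) (p : X -> R).
Hypothesis pD : forall x y, p (x + y) <= p x + p y.
Hypothesis pZ : forall a x, 0 < a -> p (a *: x) = a * p x.

(** Partial linear functionals as linear subspaces of [X * R]. Single-valuedness follows from
    domination: a pair [(0, t)] forces [t <= 0] and [- t <= 0]. *)
Let dominated_graph (G : set (X * R)) :=
  (forall a u v, G u -> G v -> G (a *: u.1 + v.1, a * u.2 + v.2)) /\
  (forall u, G u -> u.2 <= p u.1).

Let graph_ext (G : set (X * R)) (z : X) : G (0, 0) -> dominated_graph G ->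
  exists c, dominated_graph [set w | exists a u,
    [/\ G u, w.1 = u.1 + a *: z & w.2 = u.2 + a * c]].
Proof.
move=> G0 [Glin Gdom].
(* An admissible value [c] at [z] has to lie between every [u.2 - p (u.1 - z)] and every
   [p (v.1 + z) - v.2]; the supremum of the lower bounds is taken. *)
pose E := [set u.2 - p (u.1 - z) | u in G].
have ubE v : G v -> ubound E (p (v.1 + z) - v.2).
  move=> Gv _ [u Gu <-]; rewrite lerBlDr addrAC lerBrDr.
  have := Gdom _ (Glin 1 _ _ Gu Gv); rewrite /= scale1r mul1r => /le_trans; apply.
  by rewrite (_ : u.1 + v.1 = (v.1 + z) + (u.1 - z)) ?pD // addrACA subrr addr0 addrC.
have supE : has_sup E.
  split; first by exists (0 - p (0 - z)), (0, 0).
  by exists (p ((0, 0 : R).1 + z) - (0 : X, 0).2); exact: (ubE (0, 0)).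
exists (sup E); split.
  move=> a _ _ [b [u [Gu /= -> ->]]] [b' [u' [Gu' /= -> ->]]].
  exists (a * b + b'), (a *: u.1 + u'.1, a * u.2 + u'.2); split => /=.
  - exact: Glin.
  - by rewrite scalerDr scalerDl scalerA addrACA.
  - by rewrite mulrDr mulrDl mulrA addrACA.
move=> _ [a [u [Gu /= -> ->]]].
have Gs b : G (b *: u.1, b * u.2) by have := Glin b _ _ Gu G0; rewrite /= !addr0.
(* After scaling [u] by the inverse of [|a|], a negative [a] uses the lower bounds on [sup E] and a
   positive [a] the upper ones. *)
have [a0|a0|->] := ltgtP a 0; last by rewrite mul0r scale0r !addr0; exact: Gdom.
- have na0 : 0 < - a by rewrite oppr_gt0.
  have : E ((- a)^-1 * u.2 - p ((- a)^-1 *: u.1 - z)) by exists ((- a)^-1 *: u.1, (- a)^-1 * u.2).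
  move=> /(sup_upper_bound supE); rewrite -(ler_pM2l na0) mulrBr mulrA mulfV ?gt_eqF// mul1r.
  rewrite -pZ // scalerBr scalerA mulfV ?gt_eqF// scale1r scaleNr opprK.
  by rewrite mulNr; lra.
- have := ge_sup supE.1 (ubE _ (Gs a^-1)); rewrite /=.
  rewrite -(ler_pM2l a0) mulrBr mulrA mulfV ?gt_eqF// mul1r -pZ // scalerDr scalerA.
  by rewrite mulfV ?gt_eqF// scale1r; lra.
Qed.

Lemma hahn_banach (G : set (X * R)) :
  G !=set0 ->
  (forall a u v, G u -> G v -> G (a *: u.1 + v.1, a * u.2 + v.2)) ->
  (forall u, G u -> u.2 <= p u.1) ->
  exists2 f : {scalar X}, (forall x, f x <= p x) & (forall u, G u -> f u.1 = u.2).
Proof.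
move=> [u0 Gu0] Glin Gdom.
have G0 : G (0, 0).
  by have := Glin (-1) _ _ Gu0 Gu0; rewrite scaleN1r mulN1r !addNr.
(* Zorn runs over the sets [H] added to [G], so that the union of the empty chain also belongs to
   the family. *)
have [|H [[GH Hdom] Hmax]] := @Zorn_bigcup _ [set H | dominated_graph (G `|` H)].
  move=> F FP Ftot; split => [a u v|u]; last first.
    by case=> [/Gdom //|[A FA Au]]; apply: (FP A FA).2; right.
  case=> [Gu|[A FA Au]]; case=> [Gv|[B FB Bv]].
  - by left; exact: Glin.
  - have [//|//|?|?] := (FP B FB).1 a u v; [by left|by right|by left|by right; exists B].
  - have [//|//|?|?] := (FP A FA).1 a u v; [by right|by left|by left|by right; exists A].
  - have [AB|BA] := Ftot _ _ FA FB.
    + have [//|//|?|?] := (FP B FB).1 a u v;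
        [by right; exact: AB|by right|by left|by right; exists B].
    + have [//|//|?|?] := (FP A FA).1 a u v;
        [by right|by right; exact: BA|by left|by right; exists A].
set G' := G `|` H in GH Hdom Hmax.
have G'0 : G' (0, 0) by left.
(* Adjoining [x] by [graph_ext] cannot enlarge a maximal graph, so [x] already has a value. *)
have tot x : exists r, G' (x, r).
  have [c [cl cd]] := graph_ext x G'0 (conj GH Hdom).
  apply: contrapT => nx.
  apply: (Hmax [set w | exists a u,
    [/\ G' u, w.1 = u.1 + a *: x & w.2 = u.2 + a * c]]).
    split.
      by move=> u Hu; exists 0, u; rewrite scale0r mul0r !addr0; split => //; right.
    move=> h; apply: nx; exists c; right; apply: h.
    by exists 1, (0, 0); rewrite /= scale1r mul1r !add0r.
  rewrite /= (_ : G `|` _ = [set w | exists a u,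
    [/\ G' u, w.1 = u.1 + a *: x & w.2 = u.2 + a * c]]); first by split.
  apply/seteqP; split; last by move=> ?; right.
  by move=> u [Gu|//]; exists 0, u; rewrite scale0r mul0r !addr0; split => //; left.
have p0 : p 0 = 0.
  have := pZ 0 (ltr0n R 2); rewrite scaler0; lra.
have uniq x r s : G' (x, r) -> G' (x, s) -> r = s.
  move=> Gr Gs; apply/eqP; rewrite eq_le; apply/andP; split.
    by have := Hdom _ (GH (-1) _ _ Gs Gr); rewrite /= scaleN1r addNr p0; lra.
  by have := Hdom _ (GH (-1) _ _ Gr Gs); rewrite /= scaleN1r addNr p0; lra.
pose f x := projT1 (cid (tot x)).
have fP x : G' (x, f x) by exact: projT2 (cid (tot x)).
have flin : scalar f.
  by move=> a x y; apply: uniq (fP _) _; exact: (GH a _ _ (fP x) (fP y)).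
pose l : {scalar X} := HB.pack f (GRing.isLinear.Build R X R *%R f flin).
exists l.
  by move=> x /=; exact: (Hdom _ (fP x)).
by move=> [x r] Gu /=; apply: uniq (fP x) _; left.
Qed.

End hahn_banach.

(** * Countability and derived sets *)

Lemma countable_image (T U : Type) (f : T -> U) (A : set T) :
  countable A -> countable (f @` A).
Proof. exact/sub_countable/card_image_le. Qed.

Lemma countable_setU (T : Type) (A B : set T) :
  countable A -> countable B -> countable (A `|` B).
Proof.
move=> cA cB; rewrite -bigcup2inE; apply: bigcup_countable => // -[|[|]] //.
Qed.

Section topology.
Context (K : topologicalType).
Implicit Types A B D F U V : set K.

(** Second countability of the subspace [A], expressed by open sets of [K] so that no subspace type
    occurs. *)
Definition countably_based A := exists (I : countType) (W : I -> set K),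
  (forall i, open (W i)) /\
  forall x U, A x -> open U -> U x -> exists2 i, W i x & W i `&` A `<=` U.

Lemma second_countable_countably_based A :
  @second_countable A -> countably_based A.
Proof.
move=> [B /countable_injP[c cinj] [Bo Bb]].
(* All open sets of [K] with the [n]-th basic set as trace are united; the union has the same trace
   and no choice is made. *)
pose W n : set K := \bigcup_(V in [set V | open V /\ exists b : set A,
  [/\ B b, c b = n & set_val @^-1` V = b]]) V.
exists nat, W; split => [n|x U Ax oU Ux]; first by apply: bigcup_open => V [].
pose xA : A := SigSub (mem_set Ax).
have [|b [Bb' bx] bU] := Bb xA (set_val @^-1` U).
  by apply: open_nbhs_nbhs; split => //; exists U.
have [V oV Vb] := Bo b Bb'.
exists (c b); first by exists V; [split => //; exists b|move: bx; rewrite -Vb].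
move=> y [[V' [oV' [b' [Bb'' cb Vb']]] V'y] Ay].
have b'b : b' = b by apply: cinj => //; exact: mem_set.
apply: (bU (SigSub (mem_set Ay))); rewrite -b'b -Vb'.
exact: V'y.
Qed.

Lemma countably_based_second_countable A B : A `<=` B -> countably_based B ->
  @second_countable A.
Proof.
move=> AB [I [W [oW Wb]]].
exists (range (fun i => (set_val : A -> K) @^-1` (W i))).
  exact: countable_image.
split; first by move=> _ [i _ <-]; exists (W i).
move=> x U; rewrite nbhsE; case=> [Q [[V oV VO] Qx] QU].
have [||i Wx WV] := Wb (set_val x) V _ oV; first exact/AB/set_mem/valP.
  by move: Qx; rewrite -VO.
exists (set_val @^-1` (W i)); first by split => //; exists i.
move=> y Wy; apply: QU; rewrite -VO; apply: WV; split => //.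
exact/AB/set_mem/valP.
Qed.

Lemma separable_closure D : countable D -> separable (closure D : set K).
Proof.
move=> cD; exists [set x : closure D | D (set_val x)].
  apply/countable_injP; have [c cinj] := countable_injP _ cD.
  exists (c \o set_val) => x y /set_mem Dx /set_mem Dy /cinj xy.
  by apply/val_inj/xy; exact: mem_set.
move=> Q [x Qx] [V oV VO].
have /set_mem /(_ V) := valP x.
case; first by apply: open_nbhs_nbhs; split => //; move: Qx; rewrite -VO.
move=> y [Dy Vy].
by exists (SigSub (mem_set (@subset_closure _ _ _ Dy))); split => //; rewrite -VO.
Qed.

Lemma separable_subset_closure A : separable A ->
  exists D, [/\ countable D, D `<=` A & A `<=` closure D].
Proof.
move=> [D cD dD]; exists (set_val @` D); split.
- exact: countable_image.
- by move=> _ [x _ <-]; exact/set_mem/valP.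
- move=> x Ax U; rewrite nbhsE; case=> [V [oV Vx] VU].
  have [||y [Vy Dy]] := dD (set_val @^-1` V).
  + by exists (SigSub (mem_set Ax)).
  + by exists V.
  + by exists (set_val y); split; [exists y|exact: VU].
Qed.

(** For each ordered pair of distinct points of [A] fix open sets separating them. Finite
    intersections of these countably many sets form a base: by compactness, finitely many of them
    separate [x] from all of [A] outside [V]. *)
Lemma compact_countably_based A : hausdorff_space K -> compact A -> countable A ->
  countably_based A.
Proof.
rewrite open_hausdorff => hK cA /countable_injP[c cinj].
have sepP (x y : K) : exists UV : set K * set K, x != y ->
    [/\ open UV.1, open UV.2, UV.1 x, UV.2 y & UV.1 `&` UV.2 = set0].
  have [->|xy] := eqVneq x y; first by exists (setT, setT).
  have [UV [/set_mem Ux /set_mem Vy] [oU oV UV0]] := hK x y xy.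
  by exists UV => _; split => //; exact/eqP.
pose S x y := projT1 (cid (sepP x y)).
have SP x y := projT2 (cid (sepP x y)).
(* By injectivity of [c] this union has at most one member: the chosen neighbourhood of [x] away
   from [y], where [p] is the code of [(x, y)]. *)
pose U (p : nat * nat) := \bigcup_(q in [set q : K * K |
  [/\ A q.1, A q.2, q.1 != q.2 & (c q.1, c q.2) = p]]) (S q.1 q.2).1.
have oU p : open (U p).
  by apply: bigcup_open => -[x y] /= [_ _ xy _]; have [] := SP x y xy.
have UE x y : A x -> A y -> x != y -> U (c x, c y) = (S x y).1.
  move=> Ax Ay xy; apply/seteqP; split => [z [[x' y'] /= [Ax' Ay' _ [cx cy]]]|z Sz].
    have -> : x' = x by exact: (cinj x' x (mem_set Ax') (mem_set Ax) cx).
    by have -> : y' = y by exact: (cinj y' y (mem_set Ay') (mem_set Ay) cy).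
  by exists (x, y).
pose W (s : seq (nat * nat)) := foldr (fun p B => U p `&` B) setT s.
have Wcat s t : W (s ++ t) `<=` W s `&` W t.
  elim: s => [|p s IH] z /=; first by split.
  by move=> [Up /IH[Ws Wt]].
have Wcat' s t : W s `&` W t `<=` W (s ++ t).
  elim: s => [|p s IH] z /=; first by case.
  by move=> [[Up Ws] Wt]; split => //; apply: IH.
exists (seq (nat * nat)), W; split.
  by elim=> [|p s IH] /=; [exact: openT|exact: openI].
move=> x V Ax oV Vx.
have cAV : compact (A `&` ~` V) by apply: compact_closedI => //; exact: open_closedC.
have [s Ws WA] : exists2 s, W s x & forall z, W s z -> ~ (A `&` ~` V) z.
  apply: (compact_ind (P := fun B => exists2 s, W s x & forall z, W s z -> ~ B z) cAV).
  - by exists [::] => // z _ [].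
  - by move=> B B' BB' [s Ws sB']; exists s => // z /sB' nB' /BB'.
  - move=> B B' [s Ws sB] [t Wt tB']; exists (s ++ t); first exact: Wcat'.
    by move=> z /Wcat[/sB nB /tB' nB'] [].
  - move=> y [Ay Vy]; have xy : x != y by apply/eqP => xy; apply: Vy; rewrite -xy.
    have [oS1 oS2 S1x S2y S0] := SP x y xy.
    exists (S x y).2; first exact: open_nbhs_nbhs.
    exists [:: (c x, c y)] => /=; first by rewrite UE.
    move=> z [+ _] S2z; rewrite UE // => S1z.
    by have : set0 z by rewrite -S0; split.
exists s => // z [Wz Az]; apply: contrapT => Vz.
exact: WA Wz (conj Az Vz).
Qed.

Definition derived A := A `\` isolated A.

Lemma derivedS A B : A `<=` B -> derived A `<=` derived B.
Proof.
move=> AB x [Ax nix]; split; first exact: AB.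
move=> [_ [V xV VB]]; apply: nix; split; first exact/mem_set.
exists V => //; apply/seteqP; split=> [y [Vy Ay]|y ->].
  by rewrite -VB; split=> //; exact: AB.
by split=> //; exact: nbhs_singleton.
Qed.

Lemma closed_derived A : closed A -> closed (derived A).
Proof.
move=> cA x clx; have Ax : A x by apply: cA; apply: closureS clx => y [].
split => // ix; have [_ [V xV VA]] := ix.
have [y [[Ay ny] Vy]] := clx V xV.
have : [set x] y by rewrite -VA.
by move=> yx; apply: ny; rewrite yx.
Qed.

Lemma isolated_subset_dense A D : D `<=` A -> A `<=` closure D -> isolated A `<=` D.
Proof.
move=> DA AD x [/set_mem Ax [V xV VA]].
have [y [Dy Vy]] := AD x Ax V xV.
by have <- : [set x] y by rewrite -VA; split => //; exact: DA.
Qed.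

Lemma compact_discrete_finite A : compact A -> A `<=` isolated A -> finite_set A.
Proof.
move=> cA dA; rewrite -(setIid A).
apply: (compact_ind (P := fun B => finite_set (B `&` A)) cA).
- by rewrite set0I; exact: finite_set0.
- by move=> B B' BB'; apply: sub_finite_set; exact: setSI.
- by move=> B B' fB fB'; rewrite setIUl finite_setU.
- move=> x /dA[_ [V xV VA]]; exists V => //; rewrite VA; exact: finite_set1.
Qed.

Lemma CBderivative_closed a : closed (CBderivative K a).
Proof.
elim: a => [|a IHa|I u IHu] /=; first exact: closedT.
- exact: closed_derived.
- exact: closed_bigI.
Qed.

(** A point of [F] is isolated in some finite derivative of [F] or lies in the derivative of [K] of
    order [omega]. The latter is compact, and discrete because its own derivative is empty, hence
    finite. *)
Lemma countable_height_omega1 F (h : ord) :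
  compact [set: K] -> is_height K h -> ole h (osucc omega) ->
  (forall n, countable (isolated (iter n derived F))) -> countable F.
Proof.
move=> cK [h0 _] hle cF.
have w0 : CBderivative K (osucc omega) = set0.
  by apply/seteqP; split => // x /(CBderivative_anti hle); rewrite h0.
have fw : finite_set (CBderivative K omega).
  apply: compact_discrete_finite.
    by apply: subclosed_compact cK _ => //; exact: CBderivative_closed.
  by move=> x wx; apply: contrapT => nx; have : set0 x by rewrite -w0; split.
have sub n : iter n derived F `<=` CBderivative K (iter n osucc ozero).
  by elim: n => [//|n IH] /=; exact: derivedS.
apply: (@sub_countable _ _ _ ((\bigcup_n isolated (iter n derived F)) `|` CBderivative K omega)).
  apply: subset_card_le => x Fx.
  have [[n nx]|nx] := pselect (exists n, isolated (iter n derived F) x).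
    by left; exists n.
  right => n _; apply: sub.
  by elim: n => [//|n IH] /=; split => // ix; apply: nx; exists n.
apply: countable_setU; last exact: finite_set_countable.
exact: bigcup_countable.
Qed.
End topology.

(** * Continuous functions on a compact space *)

Section continuous_functions.
Context (R : realType) (K : topologicalType).
Hypotheses (cK : compact [set: K]) (hK : hausdorff_space K).
Implicit Types (f g : Cspace R cK) (A B : set K).
Local Notation C := (Cspace R cK).

(* [val] can be inferred through several canonical paths, which blocks
   rewriting; [Cval] is a fixed head symbol. *)
Definition Cval f : K -> R := val f.

Definition Cfun (g : K -> R) (cg : continuous g) : C := Sub g (asboolT cg).

Lemma CfunE (g : K -> R) (cg : continuous g) x : Cval (Cfun cg) x = g x.
Proof. by []. Qed.

Lemma Cspace_continuous f : continuous (Cval f).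
Proof. exact/asboolP/(valP f). Qed.

Lemma CspaceD f g x : Cval (f + g) x = Cval f x + Cval g x.
Proof. by rewrite /Cval raddfD. Qed.

Lemma CspaceB f g x : Cval (f - g) x = Cval f x - Cval g x.
Proof. by rewrite /Cval raddfB. Qed.

Lemma CspaceZ a f x : Cval (a *: f) x = a * Cval f x.
Proof. by []. Qed.

Lemma Cspace_sum (I : Type) (s : seq I) (F : I -> C) x :
  Cval (\sum_(i <- s) F i) x = \sum_(i <- s) Cval (F i) x.
Proof. by rewrite /Cval raddf_sum fct_sumE. Qed.

Lemma ler_Cnorm f x : `|Cval f x| <= `|f|.
Proof. exact: ler_supnorm. Qed.

Lemma Cnorm_le f M : 0 <= M -> (forall x, `|Cval f x| <= M) -> `|f| <= M.
Proof. exact: supnorm_le. Qed.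

Lemma Cspace_urysohn A B : closed A -> closed B -> A `&` B = set0 ->
  exists2 f : C, (forall x, A x -> Cval f x = 0) & (forall x, B x -> Cval f x = 1).
Proof.
move=> cA cB AB.
have [g [cg g0 g1 _]] :=
  @urysohn_ext_itv _ R (compact_normal hK cK) _ _ 0 1 cA cB AB ltr01.
exists (Cfun cg) => x; rewrite CfunE.
- by move=> Ax; apply: g0; exists x.
- by move=> Bx; apply: g1; exists x.
Qed.

Lemma Cmul_continuous f g : continuous (fun x => Cval f x * Cval g x).
Proof. by move=> x; apply: cvgM; exact: Cspace_continuous. Qed.

Definition Cmul f g : C := Cfun (@Cmul_continuous f g).

Lemma clamp_continuous e f : continuous (fun x => Num.max (- e) (Num.min e (Cval f x))).
Proof.
move=> x.
have e1 : {for x, continuous (fun=> - e : R^o)} by exact: cst_continuous.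
have e2 : {for x, continuous (fun=> e : R^o)} by exact: cst_continuous.
exact: continuous_max e1 (continuous_min e2 (@Cspace_continuous f x)).
Qed.

(** For [0 <= e] this splits [f] into a part of norm at most [e] and a remainder [f - clamp e f]
    that vanishes wherever [|f| <= e]. *)
Definition clamp e f : C := Cfun (@clamp_continuous e f).

Lemma clamp_id e f x : `|Cval f x| <= e -> Cval (clamp e f) x = Cval f x.
Proof.
rewrite ler_norml => /andP[fe ef]; rewrite CfunE.
by rewrite (min_idPr ef) (max_idPr fe).
Qed.

Lemma clamp_norm e f : 0 <= e -> `|clamp e f| <= e.
Proof.
move=> e0; apply: Cnorm_le => // x; rewrite CfunE ler_norml le_max lexx /=.
by rewrite ge_max ge_min lexx /= andbT; lra.
Qed.

Lemma closed_Cspace_ge f e : closed [set x | e <= `|Cval f x|].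
Proof.
apply: (@closed_comp _ _ (fun x => `|Cval f x|) [set y | e <= y]); last exact: closed_ge.
by move=> x _; apply: cvg_norm; exact: Cspace_continuous.
Qed.

Lemma open_Cspace_gt f e : open [set x | e < Cval f x].
Proof.
apply: (@open_comp _ _ (Cval f) [set y | e < y]); last exact: open_gt.
by move=> x _; exact: Cspace_continuous.
Qed.
End continuous_functions.

(** * Supports of functionals *)

Section support.
Context (R : realType) (K : topologicalType).
Hypotheses (cK : compact [set: K]) (hK : hausdorff_space K).
Local Notation C := (Cspace R cK).
Implicit Types (f g : C) (A B S U V : set K).
Context (phi : {scalar C}) (M : R).
Hypotheses (M0 : 0 <= M) (phiM : forall f, `|phi f| <= M * `|f|).

(** For closed [S] this says that the measure representing [phi] is carried by [S]; the form chosen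
    here avoids the Riesz representation. *)
Definition determined_on S := forall f, (forall x, S x -> Cval f x = 0) -> phi f = 0.

Lemma determined_onS A B : A `<=` B -> determined_on A -> determined_on B.
Proof. by move=> AB dA f fB; apply: dA => x /AB; exact: fB. Qed.

(** The hypothesis gives [phi f = phi (clamp e f)], which is at most [M * e] in absolute value for
    every [e > 0]. *)
Lemma truncation_eq0 f :
  (forall e, 0 < e -> phi (f - clamp e f) = 0) -> phi f = 0.
Proof.
move=> phif; apply/eqP; rewrite -normr_le0; apply/ler_addgt0Pr => e e0.
have M1 : 0 < M + 1 by rewrite ltr_wpDl.
have d0 : 0 < e / (M + 1) by rewrite divr_gt0.
have -> : phi f = phi (clamp (e / (M + 1)) f).
  by apply/eqP; rewrite -subr_eq0 -linearB phif.
apply: (le_trans (phiM _)); rewrite add0r.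
apply: (le_trans (ler_wpM2l M0 (clamp_norm _ (ltW d0)))).
by rewrite mulrA ler_pdivrMr // mulrC ler_pM2l //; lra.
Qed.

(** [clamp e f] agrees with [f] on [S], so [phi] takes the same value on both. *)
Lemma determined_on_bound S f e : determined_on S -> 0 <= e ->
  (forall x, S x -> `|Cval f x| <= e) -> `|phi f| <= M * e.
Proof.
move=> dS e0 fe; have -> : phi f = phi (clamp e f).
  apply/eqP; rewrite -subr_eq0 -linearB; apply/eqP/dS => x Sx.
  by rewrite CspaceB clamp_id ?subrr //; exact: fe.
exact: (le_trans (phiM _) (ler_wpM2l M0 (clamp_norm _ e0))).
Qed.

(** A partition of unity: with [g] the remainder of [f] above height [e] and [h] equal to 0 off [U]
    and to 1 where [|f| >= e] off [V], the product [g h] vanishes off [U] and [g - g h] vanishes off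
    [V]. *)
Lemma determined_on_setCU U V : open U -> open V ->
  determined_on (~` U) -> determined_on (~` V) -> determined_on (~` (U `|` V)).
Proof.
move=> oU oV dU dV f f0; apply: truncation_eq0 => e e0.
have [|||h h0 h1] := @Cspace_urysohn R K cK hK (~` U) ([set x | e <= `|Cval f x|] `&` ~` V).
- exact: open_closedC.
- by apply: closedI; [exact: closed_Cspace_ge|exact: open_closedC].
- apply/seteqP; split => // x [/= Ux [fx Vx]]; move: fx.
  by rewrite (f0 x) ?normr0; [rewrite leNgt e0|case].
set g := f - clamp e f.
have -> : g = Cmul g h + (g - Cmul g h) by rewrite addrC subrK.
have g0 x : `|Cval f x| <= e -> Cval g x = 0 by move=> fe; rewrite CspaceB clamp_id ?subrr.
rewrite linearD (dU (Cmul g h)) ?(dV (g - Cmul g h)) ?addr0 // => x nx.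
- rewrite CspaceB CfunE.
  have [/ltW/g0->|ef] := ltP (`|Cval f x|) e; first by rewrite mul0r subrr.
  by rewrite (h1 x) ?mulr1 ?subrr.
- by rewrite CfunE (h0 x) ?mulr0.
Qed.

(** The support of the representing measure: the complement of the union of all open sets that are
    null for [phi]. *)
Definition support : set K :=
  [set x | forall U, open U -> U x -> ~ determined_on (~` U)].

Lemma closed_support : closed support.
Proof.
move=> x clx U oU Ux dU.
have [|y [Sy Uy]] := clx U; first exact: open_nbhs_nbhs.
exact: (Sy U).
Qed.

Lemma support_subset A : closed A -> determined_on A -> support `<=` A.
Proof.
move=> cA dA x Sx; apply: contrapT => Ax.
by apply: (Sx (~` A)) => //; [exact: closed_openC|rewrite setCK].
Qed.

(** The compact set where [|f| >= e] misses the support. Compact induction, with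
    [determined_on_setCU] as its union step, covers it by one null open set, off which
    [f - clamp e f] vanishes. *)
Lemma determined_on_support : determined_on support.
Proof.
move=> f f0; apply: truncation_eq0 => e e0.
have cCe : compact [set x | e <= `|Cval f x|].
  exact: subclosed_compact (@closed_Cspace_ge _ _ _ _ _) cK (@subsetT _ _).
have [U [oU fU dU]] : exists U, [/\ open U, [set x | e <= `|Cval f x|] `<=` U &
    determined_on (~` U)].
  apply: (compact_ind (P := fun A => exists U, [/\ open U, A `<=` U & determined_on (~` U)]) cCe).
  - exists set0; split => //; first exact: open0.
    move=> g g0; suff -> : g = 0 by rewrite linear0.
    by apply/val_inj/funext => x; exact: g0.
  - by move=> A B AB [U [oU BU dU]]; exists U; split => //; exact: subset_trans AB BU.
  - move=> A B [U [oU AU dU]] [V [oV BV dV]]; exists (U `|` V); split.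
    + exact: openU.
    + exact: setUSS.
    + exact: determined_on_setCU.
  - move=> x /= ex; have : ~ support x.
      by move=> /f0 fx; move: ex; rewrite fx normr0 leNgt e0.
    move=> /existsNP[U /not_implyP[oU /not_implyP[Ux /contrapT dU]]].
    by exists U; [exact: open_nbhs_nbhs|exists U; split => //; exact: subset_refl].
apply: dU => x nUx; rewrite CspaceB clamp_id ?subrr // leNgt.
by apply/negP => /ltW /fU.
Qed.

(* If [F x] is 1 at [x] and 0 at the other points of the support, a finite signed
   sum of such functions is at most 1 on the support; hence the sum of the
   [|phi (F x)|] is at most [M]. *)
Lemma countable_isolated_support : countable (isolated support).
Proof.
have fP x : exists f, isolated support x -> [/\ Cval f x = 1,
    forall y, support y -> y != x -> Cval f y = 0 & phi f != 0].
  have [[xS [V xV VS]]|nx] := pselect (isolated support x); last by exists 0.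
  have [f fV fphi] : exists2 f, (forall y, ~ V° y -> Cval f y = 0) & phi f <> 0.
    move: xS; rewrite inE => /(_ V° (@open_interior _ _)) /(_ (nbhs_singleton (nbhs_interior xV))).
    by move=> /existsNP[f /not_implyP[fV fphi]]; exists f.
  have f0 y : support y -> y != x -> Cval f y = 0.
    move=> Sy /eqP yx; apply: fV => /interior_subset Vy; apply: yx.
    by have : [set x] y by rewrite -VS; split.
  have fx : Cval f x != 0.
    apply/eqP => fx; apply: fphi; apply: determined_on_support => y Sy.
    by have [->//|] := eqVneq y x; exact: f0.
  exists ((Cval f x)^-1 *: f) => _; split.
  - by rewrite CspaceZ mulVf.
  - by move=> y Sy yx; rewrite CspaceZ (f0 y) ?mulr0.
  - by rewrite linearZ /= mulf_neq0 ?invr_eq0 //; exact/eqP.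
pose F x := projT1 (cid (fP x)).
have FP x : isolated support x -> [/\ Cval (F x) x = 1,
    forall y, support y -> y != x -> Cval (F x) y = 0 & phi (F x) != 0].
  exact: projT2 (cid (fP x)).
have -> : isolated support = \bigcup_n (isolated support `&` [set x | n.+1%:R^-1 <= `|phi (F x)|]).
  apply/seteqP; split => [x Ix|x [n _ []//]]; have [_ _ phix] := FP x Ix.
  have [n hn] : exists n, `|phi (F x)|^-1 < n.+1%:R.
    exists (Num.truncn (`|phi (F x)|^-1)); exact: Num.Theory.truncnS_gt.
  exists n => //; split => //=.
  by rewrite -[leRHS]invrK lef_pV2 ?posrE ?invr_gt0 ?normr_gt0 // ltW.
apply: bigcup_countable => // n _; apply: finite_set_countable.
apply: contrapT => infI.
(* More than [m] points in this class would give a signed sum [g], bounded by 1 on the support, with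
   [phi g > M]. *)
have [m hm] : exists m, M * n.+1%:R < m.+1%:R.
  exists (Num.truncn (M * n.+1%:R)); exact: Num.Theory.truncnS_gt.
have [s [us sI sm]] : exists s : seq K, [/\ uniq s, forall x, x \in s ->
    isolated support x /\ n.+1%:R^-1 <= `|phi (F x)| & (m < size s)%N].
  have [E EI Em] := infinite_set_fset m.+1 infI.
  by exists (finmap.enum_fset E); split; [exact: finmap.fset_uniq|by move=> x /EI|].
pose g : C := \sum_(x <- s) Num.sg (phi (F x)) *: F x.
have gS y : support y -> `|Cval g y| <= 1.
  move=> Sy; rewrite Cspace_sum.
  have z x : x \in s -> x != y -> Cval (Num.sg (phi (F x)) *: F x) y = 0.
    move=> /sI [/FP[_ Fx _] _] xy; rewrite CspaceZ Fx ?mulr0 // eq_sym //.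
  have [yE|yE] := boolP (y \in s); last first.
    rewrite big_seq big1 ?normr0 // => x xE; apply: z => //.
    by apply: contraNneq yE => <-.
  rewrite (bigD1_seq y) ?//= big_seq_cond big1 ?addr0; last first.
    by move=> x /andP[xE xy]; exact: z.
  have [/FP[Fy _ _] _] := sI y yE.
  by rewrite CspaceZ Fy mulr1 normr_sg; case: (_ != _); rewrite //= ler01.
have : phi g <= M * 1.
  apply: le_trans (ler_norm _) _.
  exact: (determined_on_bound determined_on_support ler01 gS).
apply/negP; rewrite mulr1 -ltNge linear_sum /=.
apply: (@lt_le_trans _ _ (\sum_(x <- s) n.+1%:R^-1)); last first.
  rewrite big_seq [leRHS]big_seq; apply: ler_sum => x xE.
  by rewrite linearZ /= -normrEsg; have [_] := sI x xE.
rewrite big_const_seq count_predT iter_addr_0 -[_ *+ _]mulr_natl.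
rewrite ltr_pdivlMr //; apply: (lt_le_trans hm); rewrite ler_nat.
exact: sm.
Qed.

(** Scatteredness makes the isolated points dense in the support, and the zero set of a continuous
    function is closed. *)
Lemma scattered_determined_on_countable A : scattered K -> closed A -> determined_on A ->
  exists D, [/\ countable D, D `<=` A & determined_on D].
Proof.
move=> sK cA dA; exists (isolated support); split.
- exact: countable_isolated_support.
- by move=> x [/set_mem xS _]; exact: support_subset xS.
- move=> f f0; apply: determined_on_support => x /(sK _ closed_support) clx.
  have : closed [set x | Cval f x = 0].
    apply: (@closed_comp _ _ (Cval f) [set y | y = 0]); last exact: closed_eq.
    by move=> y _; exact: Cspace_continuous.
  by apply; exact: closureS clx.
Qed.
End support.

(** * Weak* null corrections *)

(** The image of [U] clusters in the compact segment [[- B, B]], and an ultrafilter converges to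
    each of its cluster points. *)
Lemma ultrafilter_bounded_cvg (R : realType) (U : set_system nat) (u : nat -> R) (B : R) :
  UltraFilter U -> (forall n, `|u n| <= B) -> exists l : R, u @ U --> l.
Proof.
move=> UU uB.
have UP : ProperFilter U by exact: ultra_proper.
have [|l [_ cl]] := @segment_compact R (- B) B (u @ U) _.
  by apply: (@filterS _ U _ setT) => [n _ /=|]; [rewrite in_itv /= -ler_norml|exact: filterT].
exists l => V lV.
have [//|nUV] := in_ultra_setVsetC (u @^-1` V) UU.
have [|y [nVy Vy]] := cl (~` V) V _ lV; first exact: nUV.
by case: nVy.
Qed.

Section extension.
Context (R : realType) (K : topologicalType).
Hypotheses (cK : compact [set: K]) (hK : hausdorff_space K).
Local Notation C := (Cspace R cK).
Implicit Types (f g : C) (A B S U V F : set K).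

(** A finite cover of [F] by basic sets, a rational value on each and a rational tolerance [r] form
    a code. Two functions matching one code differ by at most [2 r] on [F], so one function of [C]
    per realized code suffices; other codes get 0. *)
Lemma countably_based_dense F : closed F -> countably_based F ->
  exists g : nat -> C, forall f e, 0 < e ->
    exists k, forall x, F x -> `|Cval (f - g k) x| <= e.
Proof.
move=> clF [I [W [oW Wb]]].
pose matches f (j : seq (I * rat) * rat) :=
  (forall x, F x -> exists2 p, p \in j.1 & W p.1 x) /\
  forall p x, p \in j.1 -> F x -> W p.1 x -> `|Cval f x - ratr p.2| <= ratr j.2.
have GP j : exists g, (exists f, matches f j) -> matches g j.
  have [[f fj]|nf] := pselect (exists f, matches f j); first by exists f.
  by exists 0.
pose G j := projT1 (cid (GP j)).
have GjP j : (exists f, matches f j) -> matches (G j) j := projT2 (cid (GP j)).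
exists (fun k => if unpickle k is Some j then G j else 0) => f e e0.
have [r] := rat_in_itvoo (divr_gt0 e0 (ltr0n R 2)).
rewrite in_itv /= => /andP[r0 re].
have cF : compact F by exact: subclosed_compact clF cK (@subsetT _ _).
have [s [sF sf]] : exists s : seq (I * rat), (forall x, F x -> exists2 p, p \in s & W p.1 x) /\
    forall p x, p \in s -> F x -> W p.1 x -> `|Cval f x - ratr p.2| <= ratr r.
  apply: (compact_ind (P := fun A => exists s : seq (I * rat),
    (forall x, A x -> exists2 p, p \in s & W p.1 x) /\
    forall p x, p \in s -> F x -> W p.1 x -> `|Cval f x - ratr p.2| <= ratr r) cF).
  - by exists [::].
  - by move=> A B AB [s [sB sf]]; exists s; split => // x /AB /sB.
  - move=> A B [s [sA sf]] [t [tB tf]]; exists (s ++ t); split.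
      move=> x [/sA|/tB] [p ps Wp]; exists p => //; by rewrite mem_cat ps ?orbT.
    by move=> p x; rewrite mem_cat => /orP[/sf|/tf]; exact.
  - move=> x Fx.
    have fr : Cval f x - ratr r < Cval f x + ratr r by lra.
    have [q] := rat_in_itvoo fr; rewrite in_itv /= => /andP[q1 q2].
    have oU : open [set y | `|Cval f y - ratr q| < ratr r].
      apply: (@open_comp _ _ (fun y => `|Cval f y - ratr q|)
        [set y | y < ratr r]); last exact: open_lt.
      move=> y _; apply: cvg_norm; apply: cvgB; last exact: cvg_cst.
      exact: Cspace_continuous.
    have [|i Wx WU] := Wb x _ Fx oU; first by rewrite /= ltr_norml; lra.
    exists (W i); first exact: open_nbhs_nbhs.
    exists [:: (i, q)]; split; first by move=> y Wy; exists (i, q); rewrite ?inE.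
    by move=> p y; rewrite inE => /eqP -> Fy Wy; apply: ltW; exact: (WU y).
exists (pickle (s, r)) => x Fx; rewrite pickleK.
have [_ Gs] := GjP (s, r) (ex_intro _ f (conj sF sf)).
have [p ps Wp] := sF x Fx.
have := sf p x ps Fx Wp; have := Gs p x ps Fx Wp.
rewrite CspaceB /= => h1 h2.
rewrite (_ : _ - _ = (Cval f x - ratr p.2) - (Cval (G (s, r)) x - ratr p.2)); last first.
  by rewrite opprB addrA subrK.
by apply: (le_trans (ler_normB _ _)); lra.
Qed.

(* Veech's argument for Sobczyk's theorem: on functionals carried by [F] the
   weak* topology is metrizable on bounded sets, and every weak* cluster point
   of [psi] annihilates [Y]. *)
Lemma weak_star_null_correction F (Y : set C) (psi : nat -> {scalar C}) (M : R) :
  0 <= M -> closed F -> countably_based F ->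
  (forall n f, `|psi n f| <= M * `|f|) ->
  (forall n, determined_on (psi n) F) ->
  (forall y, Y y -> (fun n => psi n y) @ \oo --> (0 : R)) ->
  exists theta : nat -> {scalar C}, [/\ forall n f, `|theta n f| <= M * `|f|,
    forall n y, Y y -> theta n y = 0 &
    forall f, (fun n => psi n f - theta n f) @ \oo --> (0 : R)].
Proof.
move=> M0 clF bF psiM psiF psiY.
have [g gP] := countably_based_dense clF bF.
pose Z (theta : {scalar C}) := [/\ forall f, `|theta f| <= M * `|f|,
  forall y, Y y -> theta y = 0 & determined_on theta F].
(* Closeness to [psi n] on the first [N] test functions, with tolerance shrinking in [N]: a
   countable scale of weak* neighbourhoods. *)
pose good n N (theta : {scalar C}) :=
  forall k, (k < N)%N -> `|psi n (g k) - theta (g k)| <= N.+1%:R^-1.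
(* Otherwise an ultrafilter refining [\oo] contains the set of bad indices. The limit of [psi] along
   it lies in [Z] and is close to [psi n] for some bad [n]. *)
have ev_good N : \forall n \near \oo, exists2 theta, Z theta & good n N theta.
  apply: contrapT => nev.
  pose A := [set n | ~ exists2 theta, Z theta & good n N theta].
  have pA : ProperFilter (within A \oo).
    apply: Build_ProperFilter_ex => B AB; apply: contrapT => nB; apply: nev.
    have AB1 : \forall n \near \oo, A n -> B n := AB.
    apply: filterS AB1 => n An; apply: contrapT => /An Bn.
    by apply: nB; exists n.
  have [U [UU AU]] := ultraFilterLemma pA.
  have UP : ProperFilter U by exact: ultra_proper.
  have ooU : \oo `<=` U.
    move=> B oB; apply: AU.
    have h : \forall n \near \oo, A n -> B n by apply: filterS oB => n Bn _.
    exact: h.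
  have UA : U A.
    have h : \forall n \near \oo, A n -> A n by exact: nearW.
    by apply: AU; exact: h.
  have lP f : exists l : R, (fun n => psi n f) @ U --> l.
    exact: ultrafilter_bounded_cvg (fun n => psiM n f).
  pose theta f := projT1 (cid (lP f)).
  have thetaP f : (fun n => psi n f) @ U --> theta f := projT2 (cid (lP f)).
  have thetaE f (l : R) : (fun n => psi n f) @ U --> l -> theta f = l.
    by move=> /(cvg_unique (@Rhausdorff R) (thetaP f)).
  have thetalin : scalar theta.
    move=> a f h; apply: thetaE.
    under eq_fun do rewrite linearP.
    by apply: cvgD => //; apply: cvgMr.
  pose th : {scalar C} := HB.pack theta (GRing.isLinear.Build R C R *%R theta thetalin).
  have Zth : Z th.
    split.
    - move=> f; apply: (@closed_cvg _ _ U _ (fun n => psi n f)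
        [set y : R | `|y| <= M * `|f|]) (thetaP f).
        apply: (@closed_comp _ _ (fun y : R => `|y|)
          [set y | y <= M * `|f|]); last exact: closed_le.
        by move=> y _; exact: norm_continuous.
      by apply: (@filterS _ U _ setT); [move=> n _; exact: psiM|exact: filterT].
    - by move=> y Yy; apply: thetaE => V /(psiY y Yy); exact: ooU.
    - move=> f f0; apply: thetaE; under eq_fun do rewrite (psiF _ f f0).
      exact: cvg_cst.
  have Ugood : U [set n | forall k : 'I_N, `|psi n (g k) - th (g k)| <= N.+1%:R^-1].
    apply: filter_forall => k.
    have /cvgrPdist_le /(_ N.+1%:R^-1) := thetaP (g k).
    rewrite invr_gt0 ltr0n => /(_ isT); apply: filterS => n.
    by rewrite distrC.
  have [n [An ng]] := filter_ex (filterI UA Ugood).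
  by apply: An; exists th => // k kN; exact: (ng (Ordinal kN)).
(* Goodness at a level implies goodness at all lower levels, so the highest attainable level up to
   [m] is taken; level 0 is vacuous and is served by the zero functional. Taking [m = n] below
   brings every fixed level eventually into range. *)
have best n m : exists2 theta, Z theta & forall N, (N <= m)%N ->
    (exists2 theta', Z theta' & good n N theta') -> good n N theta.
  elim: m => [|m [th Zth IH]].
    have lin0 : scalar (fun _ : C => 0 : R) by move=> a f h; rewrite mulr0 addr0.
    exists (HB.pack_for {scalar C} (fun _ : C => 0 : R) (GRing.isLinear.Build R C R *%R _ lin0)).
      split => //= f; by rewrite normr0 mulr_ge0.
    by move=> N; rewrite leqn0 => /eqP -> _ k.
  have [[th' Zth' th'g]|nth] := pselect (exists2 th', Z th' & good n m.+1 th').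
    exists th' => // N Nm _ k kN; apply: (le_trans (th'g k (leq_trans kN Nm))).
    by rewrite lef_pV2 ?posrE // ler_nat ltnS.
  exists th => // N; rewrite leq_eqVlt => /predU1P[->//|]; rewrite ltnS; exact: IH.
pose theta n := projT1 (cid2 (best n n)).
have thetaZ n : Z (theta n) by rewrite /theta; case: cid2.
have thetaB n N : (N <= n)%N -> (exists2 th, Z th & good n N th) -> good n N (theta n).
  by rewrite /theta; case: cid2 => /= th _; apply.
exists theta; split.
- by move=> n; have [] := thetaZ n.
- by move=> n; have [] := thetaZ n.
move=> f; apply/cvgr0Pnorm_le => e e0.
(* Replacing [f] by a [g k] within [e / (4 * (M + 1))] on [F] costs at most [e / 4] for each of
   [psi n] and [theta n]; goodness supplies the remaining [e / 2]. *)
have M1 : 0 < 4 * (M + 1) by rewrite mulr_gt0 // ltr_wpDl.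
have d0 : 0 < e / (4 * (M + 1)) by rewrite divr_gt0.
have Md : M * (e / (4 * (M + 1))) <= e / 4.
  rewrite mulrA ler_pdivrMr // (_ : e / 4 * _ = e * (M + 1)); last by field.
  by rewrite mulrC ler_pM2l //; lra.
have [k gk] := gP f _ d0.
have [m hm] : exists m, (e / 2)^-1 < m.+1%:R.
  by exists (Num.truncn (e / 2)^-1); exact: Num.Theory.truncnS_gt.
(* [N > k] puts [g k] among the test functions, and [N >= m] makes the tolerance at most [e / 2]. *)
pose N := maxn k.+1 m.
near=> n.
have nN : (N <= n)%N by near: n; exact: nbhs_infty_ge.
have [_ _ thF] := thetaZ n.
have [thM _ _] := thetaZ n.
have gn : good n N (theta n).
  by apply: thetaB => //; near: n; exact: ev_good.
have h1 := gn k (leq_maxl _ _).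
have h2 : N.+1%:R^-1 <= e / 2.
  rewrite -[leRHS]invrK lef_pV2 ?posrE ?invr_gt0 ?divr_gt0 //.
  by apply: (le_trans (ltW hm)); rewrite ler_nat ltnS leq_maxr.
have h3 := determined_on_bound M0 (psiM n) (psiF n) (ltW d0) gk.
have h4 := determined_on_bound M0 thM thF (ltW d0) gk.
move: h3 h4; rewrite !linearB /= => h3 h4.
rewrite (_ : _ - _ = (psi n f - psi n (g k)) - (theta n f - theta n (g k)) +
   (psi n (g k) - theta n (g k))); last by ring.
apply: (le_trans (ler_normD _ _)); apply: (@le_trans _ _ (e / 4 + e / 4 + e / 2)); last by lra.
apply: lerD; last exact: le_trans h1 h2.
by apply: (le_trans (ler_normB _ _)); apply: lerD; apply: le_trans Md.
Unshelve. all: by end_near.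
Qed.
End extension.

(** * Extension of operators *)

Section c0.
Context (R : realType).
Implicit Types u v : c0 R.

Definition c0val u : nat -> R := val u.

Lemma c0val_cvg u : c0val u @ \oo --> (0 : R).
Proof. exact/asboolP/(valP u). Qed.

Lemma c0valP a u v n : c0val (a *: u + v) n = a * c0val u n + c0val v n.
Proof. by []. Qed.

Lemma ler_c0norm u n : `|c0val u n| <= `|u|.
Proof. exact: ler_supnorm. Qed.

Lemma c0norm_le u B : 0 <= B -> (forall n, `|c0val u n| <= B) -> `|u| <= B.
Proof. exact: supnorm_le. Qed.

(** Bounded operators into [c0] amount to uniformly bounded, pointwise null sequences of
    functionals; here the operator is assembled from its coordinates. *)
Lemma coordinatewise_operator (X : normedModType R) (phi : nat -> {scalar X}) (M : R) :
  0 <= M -> (forall n x, `|phi n x| <= M * `|x|) ->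
  (forall x, (fun n => phi n x) @ \oo --> (0 : R)) ->
  exists2 T : {linear X -> c0 R}, bounded_operator T &
    forall x n, c0val (T x) n = phi n x.
Proof.
move=> M0 phiM phi0.
pose t x : c0 R := Sub (fun n => phi n x) (asboolT (phi0 x)).
have tlin : linear t by move=> a x y; apply/val_inj/funext => n; rewrite /= linearP.
exists (HB.pack_for {linear X -> c0 R} t (GRing.isLinear.Build R X (c0 R) *:%R t tlin)) => //=.
exists M => x; apply: c0norm_le => [|n]; first by rewrite mulr_ge0.
exact: phiM.
Qed.
End c0.

Section sobczyk.
Context (R : realType) (K : topologicalType).
Hypotheses (cK : compact [set: K]) (hK : hausdorff_space K) (sK : scattered K).
Local Notation C := (Cspace R cK).
Implicit Types (f g : C) (A B D F : set K).

(** The extension has the coordinates [psi n - theta n]: they are pointwise null by the weak*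
    correction and agree with [T] on [Y], which [theta n] annihilates. *)
Lemma monolithic_c0_extension : monolithic K -> c0_extension_property C.
Proof.
move=> mK Y _ T [M0 TM0].
(* [bounded_operator] imposes no sign on its constant. *)
pose M : R := `|M0|.
have M_ge0 : 0 <= M by exact: normr_ge0.
have TM y : `|T y| <= M * `|y|.
  by apply: (le_trans (TM0 y)); rewrite ler_wpM2r // ler_norm.
have pD f g : M * `|f + g| <= M * `|f| + M * `|g|.
  by rewrite -mulrDr ler_wpM2l // ler_normD.
have pZ a f : 0 < a -> M * `|a *: f| = a * (M * `|f|).
  by move=> a0; rewrite normrZ (gtr0_norm a0) mulrCA.
have ext n : exists2 psi : {scalar C}, (forall f, `|psi f| <= M * `|f|) &
    forall y : subnormed Y, psi (val y) = c0val (T y) n.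
  have [|||psi psiM psiT] := @hahn_banach R C (fun f => M * `|f|) pD pZ
      (range (fun y : subnormed Y => (val y, c0val (T y) n))).
  - by exists (val (0 : subnormed Y), c0val (T 0) n), 0.
  - move=> a _ _ [y _ <-] [z _ <-] /=; exists (a *: y + z) => //.
    by rewrite linearP c0valP.
  - move=> _ [y _ <-] /=; apply: le_trans (TM y).
    by apply: le_trans (ler_norm _) _; exact: ler_c0norm.
  exists psi.
    move=> f; rewrite ler_norml psiM andbT.
    by rewrite lerNl -linearN -normrN; exact: psiM.
  by move=> y; apply: (psiT (val y, c0val (T y) n)); exists y.
pose psi n := projT1 (cid2 (ext n)).
have psiM n f : `|psi n f| <= M * `|f| by rewrite /psi; case: cid2.
have psiT n (y : subnormed Y) : psi n (val y) = c0val (T y) n by rewrite /psi; case: cid2.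
have cD n : exists D, countable D /\ determined_on (psi n) D.
  have [|D [cD _ dD]] := scattered_determined_on_countable hK M_ge0 (psiM n) sK (@closedT K).
    by move=> f f0; rewrite (_ : f = 0) ?linear0 //; apply/val_inj/funext => x; exact: f0.
  by exists D.
pose D n := projT1 (cid (cD n)).
have DP n : countable (D n) /\ determined_on (psi n) (D n) := projT2 (cid (cD n)).
pose F := closure (\bigcup_n D n).
have bF : countably_based F.
  apply/second_countable_countably_based/mK/separable_closure.
  by apply: bigcup_countable => // n _; have [] := DP n.
have dF n : determined_on (psi n) F.
  apply: determined_onS (DP n).2 => x Dx; apply: subset_closure; by exists n.
have [||theta [thM thY th0]] := weak_star_null_correction (Y := [set` Y]) M_ge0 _ bF psiM dF.
- exact: closed_closure.
- move=> y Yy; pose y' : subnormed Y := exist _ y Yy.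
  have -> : (fun n => psi n y) = c0val (T y') by apply/funext => n; exact: (psiT n y').
  exact: c0val_cvg.
have dlin n : scalar (fun f => psi n f - theta n f).
  move=> a f g.
  have -> : psi n (a *: f + g) = a * psi n f + psi n g by exact: linearP.
  have -> : theta n (a *: f + g) = a * theta n f + theta n g by exact: linearP.
  by ring.
pose d n : {scalar C} := HB.pack (fun f => psi n f - theta n f)
  (GRing.isLinear.Build R C R *%R _ (dlin n)).
have [||T' bT' T'E] := @coordinatewise_operator R C d (M + M) _ _ th0.
- by rewrite addr_ge0.
- move=> n f /=; rewrite mulrDl; apply: (le_trans (ler_normB _ _)).
  exact: lerD.
exists T' => // y; apply/val_inj/funext => n.
rewrite -[LHS]/(c0val _ n) T'E /= psiT thY ?subr0 //.
exact (valP y).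
Qed.
End sobczyk.

(** * Separability of derived sets *)

Lemma finite_set_eventually_notin (B : set nat) :
  finite_set B -> \forall n \near \oo, ~ B n.
Proof.
move=> /finite_fsetP[X ->]; exists (\max_(i <- finmap.enum_fset X) i).+1 => // n /= mn nX.
have : (n <= \max_(i <- finmap.enum_fset X) i)%N by exact: (@leq_bigmax_seq _ _ predT id).
by rewrite leqNgt mn.
Qed.

Lemma null_sequence_finite (R : realType) (u : nat -> R) (e : R) :
  u @ \oo --> (0 : R) -> 0 < e -> finite_set [set n | e <= `|u n|].
Proof.
move=> /cvgr0Pnorm_lt u0 /u0 [N _ uN]; apply: (@sub_finite_set _ _ `I_N); last exact: finite_II.
move=> n /= en; rewrite ltnNge; apply/negP => /uN /=.
by rewrite ltNge en.
Qed.

Section vanishing.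
Context (R : realType) (K : topologicalType) (cK : compact [set: K]) (G : set K).
Local Notation C := (Cspace R cK).

(** With [G] the derived set of [F], this closed ideal is the domain of the operator to be
    extended. *)
Definition vanishing_pred : {pred C} := fun f => `[< forall x, G x -> Cval f x = 0 >].

Let vanishing_submod : GRing.submod_closed vanishing_pred.
Proof.
split=> [|a f g /asboolP f0 /asboolP g0]; first by apply/asboolP.
by apply/asboolP => x Gx; rewrite CspaceD CspaceZ f0 // g0 // mulr0 addr0.
Qed.

HB.instance Definition _ :=
  GRing.isSubmodClosed.Build R C vanishing_pred vanishing_submod.

Definition vanishing : GRing.SubmodClosed.type C := vanishing_pred.

Lemma vanishingP (f : C) : reflect (forall x, G x -> Cval f x = 0) (f \in vanishing).
Proof. exact: asboolP. Qed.

Lemma closed_vanishing : closed [set` vanishing].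
Proof.
move=> f clf; apply/vanishingP => x Gx; apply/eqP; rewrite -normr_le0.
apply/ler_addgt0Pr => e e0; rewrite add0r.
have [g [/= /vanishingP g0]] := clf _ (nbhsx_ballx f e e0).
rewrite -ball_normE /= => fg; apply: le_trans (ltW fg).
by apply: le_trans (ler_Cnorm _ x); rewrite CspaceB g0 // subr0.
Qed.
End vanishing.

Section separable_derived.
Context (R : realType) (K : topologicalType).
Hypotheses (cK : compact [set: K]) (hK : hausdorff_space K) (sK : scattered K).
Local Notation C := (Cspace R cK).
Implicit Types (f g : C) (A B D F : set K).

(** For [y] vanishing on [derived F], the points of [F] where [|y| >= eps] form a compact set of
    isolated points, hence a finite one; so the values at the points numbered by [c] tend to 0. *)
Lemma evaluation_operator F : closed F -> countable (isolated F) ->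
  exists c : K -> nat, exists2 T : {linear subnormed (vanishing R cK (derived F)) -> c0 R},
    bounded_operator T & {in (isolated F : set K) &, injective c} /\
    forall y x, isolated F x -> c0val (T y) (c x) = Cval (val y) x.
Proof.
move=> clF /countable_injP[c cinj].
(* Coordinates that number no isolated point are set to 0. *)
pose e n (f : C) : R := if pselect (exists2 x, isolated F x & c x = n) is left h
  then Cval f (projT1 (cid2 h)) else 0.
have eE x f : isolated F x -> e (c x) f = Cval f x.
  move=> Ix; rewrite /e; case: pselect => [h|[]]; last by exists x.
  case: cid2 => z Iz cz /=; congr (Cval f _).
  by apply: cinj cz; exact: mem_set.
have elin n : scalar (e n).
  move=> a f g; rewrite /e; case: pselect => [h|_]; last by rewrite mulr0 addr0.
  by rewrite CspaceD CspaceZ.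
have e1 n f : `|e n f| <= `|f|.
  by rewrite /e; case: pselect => [h|_]; [exact: ler_Cnorm|rewrite normr0].
pose Y := vanishing R cK (derived F).
have e0 (y : subnormed Y) : (fun n => e n (val y)) @ \oo --> (0 : R).
  apply/cvgr0Pnorm_lt => eps eps0.
  pose A := F `&` [set x | eps <= `|Cval (val y) x|].
  have AI : A `<=` isolated F.
    move=> x [Fx /= yx]; apply: contrapT => nx; move: yx.
    have /vanishingP -> := valP y; last by split.
    by rewrite normr0 leNgt eps0.
  have fA : finite_set A.
    apply: compact_discrete_finite.
      apply: subclosed_compact cK (@subsetT _ _).
      by apply: closedI => //; exact: closed_Cspace_ge.
    move=> x Ax; have [_ [V xV VF]] := AI x Ax; split; first exact: mem_set.
    exists V => //; apply/seteqP; split => [z [Vz [Fz _]]|z ->].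
      by rewrite -VF.
    by split => //; exact: nbhs_singleton.
  apply: filterS (finite_set_eventually_notin (finite_image c fA)) => n nA.
  rewrite ltNge; apply/negP => en; apply: nA.
  move: en; rewrite /e; case: pselect => [h|_]; last by rewrite normr0 leNgt eps0.
  case: cid2 => x Ix cx /= en; exists x => //; split => //.
  by have [/set_mem] := Ix.
pose phi n (y : subnormed Y) := e n (val y).
have philin n : scalar (phi n).
  by move=> a y z; rewrite /phi linearP elin.
pose ph n : {scalar subnormed Y} := HB.pack (phi n)
  (GRing.isLinear.Build R (subnormed Y) R *%R _ (philin n)).
have [|T bT TE] := @coordinatewise_operator R (subnormed Y) ph 1 ler01 _ e0.
  by move=> n y; rewrite mul1r; exact: e1.
exists c, T => //; split => // y x Ix.
by rewrite TE; exact: eE.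
Qed.

(** [nu x] kills all functions vanishing on [derived F], because [T'] extends evaluation there;
    hence it is determined on a countable [S x] inside [derived F]. The union of the [S x] is dense:
    a function vanishing on it agrees at the isolated points with a null sequence, so it cannot be 1
    at a point of [derived F], where isolated points accumulate. *)
Lemma c0_extension_separable_derived F D : c0_extension_property C ->
  closed F -> countable D -> D `<=` F -> F `<=` closure D ->
  exists D', [/\ countable D', D' `<=` derived F & derived F `<=` closure D'].
Proof.
move=> eC clF cD DF FD.
have cI : countable (isolated F).
  by apply: sub_countable cD; apply: subset_card_le; exact: isolated_subset_dense.
have [c [T bT [cinj TE]]] := evaluation_operator clF cI.
have [T' [M0 TM0] T'E] := eC _ (@closed_vanishing R K cK (derived F)) T bT.
(* The 1 bounds the evaluation at [x], the other term the coordinate of [T']. *)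
pose M := 1 + `|M0|.
have M_ge0 : 0 <= M by rewrite addr_ge0.
have nulin x : scalar (fun f : C => Cval f x - c0val (T' f) (c x)).
  by move=> a f g; rewrite linearP c0valP CspaceD CspaceZ; ring.
pose nu x : {scalar C} := HB.pack (fun f : C => Cval f x - c0val (T' f) (c x))
  (GRing.isLinear.Build R C R *%R _ (nulin x)).
have nuM x f : `|nu x f| <= M * `|f|.
  rewrite /= mulrDl mul1r; apply: le_trans (ler_normB _ _) (lerD (ler_Cnorm _ _) _).
  apply: le_trans (ler_c0norm _ _) (le_trans (TM0 _) _).
  by rewrite ler_wpM2r // ler_norm.
have cld : closed (derived F) by exact: closed_derived.
have Dx x : exists D, isolated F x -> [/\ countable D, D `<=` derived F & determined_on (nu x) D].
  have [Ix|nx] := pselect (isolated F x); last by exists set0.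
  have [|D' D'P] := scattered_determined_on_countable hK M_ge0 (nuM x) sK cld.
    move=> f f0 /=; have fY : f \in vanishing R cK (derived F) by exact/vanishingP.
    by have := T'E (Sub f fY); rewrite /= => ->; rewrite TE //= subrr.
  by exists D'.
pose S x := projT1 (cid (Dx x)).
have SP x : isolated F x -> [/\ countable (S x), S x `<=` derived F & determined_on (nu x) (S x)].
  exact: projT2 (cid (Dx x)).
exists (\bigcup_(x in isolated F) S x); split.
- by apply: bigcup_countable => // x /SP[].
- by move=> y [x /SP[_ SF _] /SF].
move=> x dx; apply: contrapT => nx.
have [|||f f0 f1] := @Cspace_urysohn R K cK hK
    (closure (\bigcup_(x in isolated F) S x)) [set x].
- exact: closed_closure.
- by apply: accessible_closed_set1; exact: hausdorff_accessible.
- by apply/seteqP; split => // y [cy yx]; apply: nx; rewrite -yx.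
have eqf z : isolated F z -> Cval f z = c0val (T' f) (c z).
  move=> Iz; apply/eqP; rewrite -subr_eq0; apply/eqP.
  have [_ _ dS] := SP z Iz.
  by apply: (dS f) => y Sy; apply: f0; apply: subset_closure; exists z.
have oU : open [set z | 2^-1 < Cval f z] by exact: open_Cspace_gt.
(* [c] maps these points injectively into the finite set where the null sequence [T' f] is at least
   1/2. *)
have fin : finite_set (isolated F `&` [set z | 2^-1 < Cval f z]).
  have half0 : (0 : R) < 2^-1 by rewrite invr_gt0.
  have finc := null_sequence_finite (@c0val_cvg R (T' f)) half0.
  rewrite -(eq_finite_set (inj_card_eq (f := c) _)); last first.
    by move=> y z /set_mem[Iy _] /set_mem[Iz _]; apply: cinj; exact: mem_set.
  apply: sub_finite_set finc => _ [y [Iy /= fy] <-]; rewrite /= -eqf //.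
  exact: le_trans (ltW fy) (ler_norm _).
have clE : closed (isolated F `&` [set z | 2^-1 < Cval f z]).
  by apply: compact_closed => //; exact: finite_compact.
have [[Fx nIx] half] : derived F x /\ (2^-1 : R) < 1 by split => //; lra.
have clx : closure (isolated F) x by exact: (sK clF).
(* Removing the finite set of exceptional isolated points leaves a neighbourhood of the non-isolated
   point [x], which still meets [isolated F]. *)
have [|z [Iz [Ez fz]]] := clx
  ([set z | 2^-1 < Cval f z] `&` ~` (isolated F `&` [set z | 2^-1 < Cval f z])).
  apply: open_nbhs_nbhs; split.
    by apply: openI => //; exact: closed_openC.
  by split => [/=|[/nIx]//]; rewrite (f1 x).
by apply: fz.
Qed.
End separable_derived.

(** * From the extension property to monolithicity, and the equivalence *)

Lemma c0_extension_monolithic (R : realType) (K : topologicalType)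
    (cK : compact [set: K]) (hK : hausdorff_space K) (sK : scattered K)
    (h : ord) (hh : is_height K h) (h_le : ole h (osucc omega)) :
  c0_extension_property (Cspace R cK) -> monolithic K.
Proof.
move=> eC A /separable_subset_closure[D [cD _ AD]].
pose F := closure D; have clF : closed F by exact: closed_closure.
(* Closedness is carried through the induction, since passing to the next derived set requires
   it. *)
have sepF n : closed (iter n (@derived K) F) /\ exists E,
    [/\ countable E, E `<=` iter n (@derived K) F & iter n (@derived K) F `<=` closure E].
  elim: n => [|n [cn [E [cE EF FE]]]] /=.
    by split => //; exists D; split => //; exact: subset_closure.
  split; first exact: closed_derived.
  exact: (c0_extension_separable_derived hK sK eC cn cE EF FE).
have cF : countable F.
  apply: (countable_height_omega1 cK hh h_le) => n; have [_ [E [cE EF FE]]] := sepF n.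
  by apply: sub_countable cE; apply: subset_card_le; exact: isolated_subset_dense.
(* [A] need not be closed; it inherits its base from the countable compact set [F]. *)
apply: (countably_based_second_countable AD).
by apply: compact_countably_based => //; exact: subclosed_compact clF cK (@subsetT _ _).
Qed.

Theorem theorem3p15 (R : realType) (K : topologicalType)
    (cK : compact [set: K]) (hK : hausdorff_space K) (sK : scattered K)
    (h : ord) (hh : is_height K h) (h_le : ole h (osucc omega)) :
  c0_extension_property (Cspace R cK) <-> monolithic K.
Proof.
split; first exact: (c0_extension_monolithic hK sK hh h_le).
exact: monolithic_c0_extension.
Qed.
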